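(* For every natural number $k$, any standard smooth scheme of dimension $k$ is smooth of dimension $k$.
   Context: We work in homotopy type theory with univalent universes and propositional truncation (neither excluded middle nor the axiom of choice is assumed). ''Merely'', ''there exists'' and disjunction refer to propositional truncation; a map is surjective if its fibers are merely inhabited. Fix a commutative ring $R$. A finitely presented $R$-algebra is one merely of the form $R[X_1,\dots,X_n]/(P_1,\dots,P_l)$; for such $A$, $\mathrm{Spec}(A)$ is the type of $R$-algebra homomorphisms $A\to R$, and for $a:A$, $x:\mathrm{Spec}(A)$ one writes $a(x)=x(a)$. A Zariski-cover of $\mathrm{Spec}(A)$ is a finite family of subtypes $U_i=\{x\mid f_i(x)\text{ invertible}\}$ with $f_1,\dots,f_n:A$ generating the unit ideal. Axioms: (Locality) $R$ is local: $1\neq 0$, and if $x+y$ is invertible then $x$ or $y$ is invertible. (Duality) For every finitely presented $R$-algebra $A$ the map $A\to(\mathrm{Spec}(A)\to R)$, $a\mapsto(\varphi\mapsto\varphi(a))$ is an isomorphism of $R$-algebras. (Zariski-local choice) For every finitely presented $R$-algebra $A$ and family $B$ of merely inhabited types over $\mathrm{Spec}(A)$, there merely exist a Zariski-cover $U_1,\dots,U_n$ of $\mathrm{Spec}(A)$ and dependent functions $s_i:(x:U_i)\to B(x)$. A proposition is open if it is merely of the form $r_1\neq 0\vee\dots\vee r_n\neq 0$ with $r_i:R$, and closed if merely of the form $r_1=0\wedge\dots\wedge r_n=0$. A subtype $U$ of a type $X$ is open if $x\in U$ is an open proposition for all $x:X$. An affine scheme is a type merely of the form $\mathrm{Spec}(A)$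 with $A$ a finitely presented $R$-algebra; a scheme is a type that merely has a finite cover by open subtypes that are affine schemes. A closed proposition is dense (closed dense) if it is merely of the form $r_1=0\wedge\dots\wedge r_n=0$ with all $r_i$ nilpotent. A type $X$ is formally smooth if for every closed dense proposition $P$ the map $X\to X^P$ sending $x$ to the constant map is surjective. A smooth scheme is a scheme which is formally smooth as a type. Let $\mathbb{D}(1)=\{\epsilon:R\mid\epsilon^2=0\}$ and $\mathbb{D}(2)=\{(a,b):R^2\mid a^2=ab=b^2=0\}$. For a scheme $X$ and $x:X$, the tangent space $T_x(X)=\{t:\mathbb{D}(1)\to X\mid t(0)=x\}$ is an $R$-module with $(rv)(\epsilon)=v(r\epsilon)$ and $(v+w)(\epsilon)=\psi_{v,w}(\epsilon,\epsilon)$, where $\psi_{v,w}:\mathbb{D}(2)\to X$ is the unique pointed map (sending $0$ to $x$) restricting to $v$ and $w$ on the two axes. A scheme is smooth of dimension $n$ if it is smooth and all its tangent spaces are finite free of dimension $n$ (merely isomorphic to $R^n$). A standard smooth scheme of dimension $k$ is an affine scheme (merely) of the form $\mathrm{Spec}(R[X_1,\dots,X_n,Y_1,\dots,Y_k]/(P_1,\dots,P_n))$ where the determinant of $\left(\frac{\partial P_i}{\partial X_j}\right)_{1\leq i,j\leq n}$ is invertible in $R[X_1,\dots,X_n,Y_1,\dots,Y_k]/(P_1,\dots,P_n)$. *)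

(* Defs.v *)
From Stdlib Require Import FunctionalExtensionality PropExtensionality.
From Stdlib Require Import ProofIrrelevance Ring Setoid.
From Stdlib Require Import RelationClasses.
From HB Require Import structures.
From mathcomp Require Import all_boot.
From mathcomp Require Import perm.

Set Implicit Arguments.
Unset Strict Implicit.
Unset Printing Implicit Defensive.

(** Ambient logic.  Rocq types play the role of the sets of homotopy type theory
    and [Prop] that of the type of propositions, so that "merely", "there
    exists" and "or" are [inhabited], [exists] and [\/] in [Prop].  Function and
    propositional extensionality are the axioms of the standard library.  What
    [Prop] still lacks is that truncations eliminate into every proposition,
    including contractible types; this is [unique_choice], which is a theorem
    of homotopy type theory and does not imply excluded middle.

    Excluded middle refutes [duality] over a nontrivial ring, so the results
    are meant to be derived without classical axioms.  Likewise the MathComp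
    ring structures cannot be used, because they carry a boolean equality
    test; only the index types ['I_n], ['S_n] and the iterated operators are
    taken from MathComp. *)
Definition unique_choice : Type :=
  forall (T : Type) (P : T -> Prop), (exists! x, P x) -> {x : T | P x}.

Definition surjective (S T : Type) (f : S -> T) : Prop :=
  forall y, exists x, f x = y.

Section Quotient.

(** Set quotients, as types of equivalence classes. *)
Variables (T : Type) (E : T -> T -> Prop).

Definition is_class (S : T -> Prop) : Prop :=
  exists a, forall b, S b <-> E a b.

Definition quot : Type := {S : T -> Prop | is_class S}.

Definition cls (a : T) : quot :=
  exist _ (E a) (ex_intro _ a (fun b => iff_refl (E a b))).

Lemma quot_ext (s t : quot) :
  (forall a, sval s a <-> sval t a) -> s = t.
Proof.
case: s t => [S HS] [S' HS'] /= eqS.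
have e : S = S'.
  by apply: functional_extensionality => a; apply: propositional_extensionality.
by subst S'; rewrite (proof_irrelevance _ HS HS').
Qed.

Lemma clsP (s : quot) : exists a, s = cls a.
Proof.
case: (svalP s) => a Ha; exists a; apply: quot_ext => b; exact: Ha.
Qed.

Hypothesis equivE : Equivalence E.

Lemma cls_eq (a b : T) : cls a = cls b <-> E a b.
Proof.
split=> [e | Hab].
  have : sval (cls b) b by rewrite /=; reflexivity.
  by rewrite -e.
apply: quot_ext => c /=; split=> H.
  by transitivity a => //; symmetry.
by transitivity b.
Qed.

Section Map1.
Variables (f : T -> T) (fP : forall a b, E a b -> E (f a) (f b)).

Lemma map1_subproof (s : quot) :
  is_class (fun c => exists a, sval s a /\ E (f a) c).
Proof.
case: (clsP s) => a ->; exists (f a) => c /=; split.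
  by case=> b [Hab Hc]; transitivity (f b) => //; apply: fP.
by move=> Hc; exists a; split=> //; reflexivity.
Qed.

Definition quot_map1 (s : quot) : quot := exist _ _ (map1_subproof s).

Lemma quot_map1E a : quot_map1 (cls a) = cls (f a).
Proof.
apply: quot_ext => c /=; split.
  by case=> b [Hab Hc]; transitivity (f b) => //; apply: fP.
by move=> Hc; exists a; split=> //; reflexivity.
Qed.
End Map1.

Section Map2.
Variables (f : T -> T -> T).
Hypothesis fP : forall a b c d, E a b -> E c d -> E (f a c) (f b d).

Lemma map2_subproof (s t : quot) :
  is_class (fun e => exists a c, sval s a /\ sval t c /\ E (f a c) e).
Proof.
case: (clsP s) => a ->; case: (clsP t) => c ->.
exists (f a c) => e /=; split.
  by case=> b [d] [Hab [Hcd He]]; transitivity (f b d) => //; apply: fP.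
by move=> He; exists a, c; split; [reflexivity | split; [reflexivity |]].
Qed.

Definition quot_map2 (s t : quot) : quot := exist _ _ (map2_subproof s t).

Lemma quot_map2E a c : quot_map2 (cls a) (cls c) = cls (f a c).
Proof.
apply: quot_ext => e /=; split.
  by case=> b [d] [Hab [Hcd He]]; transitivity (f b d) => //; apply: fP.
by move=> He; exists a, c; split; [reflexivity | split; [reflexivity |]].
Qed.
End Map2.

End Quotient.

Record comRing : Type := ComRing {
  car :> Type;
  r0 : car;
  r1 : car;
  radd : car -> car -> car;
  rmul : car -> car -> car;
  ropp : car -> car;
  rlaws : ring_theory r0 r1 radd rmul (fun x y => radd x (ropp y)) ropp eq
}.

Arguments r0 {_}.
Arguments r1 {_}.
Arguments radd {_} _ _.
Arguments rmul {_} _ _.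
Arguments ropp {_} _.

Declare Scope cring_scope.
Delimit Scope cring_scope with cR.
Notation "0" := r0 : cring_scope.
Notation "1" := r1 : cring_scope.
Notation "x + y" := (radd x y) : cring_scope.
Notation "x * y" := (rmul x y) : cring_scope.
Notation "- x" := (ropp x) : cring_scope.
Notation "x - y" := (radd x (ropp y)) : cring_scope.
Local Open Scope cring_scope.

HB.instance Definition _ (A : comRing) := Monoid.isComLaw.Build A r0 radd
  (Radd_assoc (rlaws A)) (Radd_comm (rlaws A)) (Radd_0_l (rlaws A)).

HB.instance Definition _ (A : comRing) := Monoid.isComLaw.Build A r1 rmul
  (Rmul_assoc (rlaws A)) (Rmul_comm (rlaws A)) (Rmul_1_l (rlaws A)).

Definition rexp (A : comRing) (x : A) (m : nat) : A := iter m (rmul x) 1.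

Definition is_unit (A : comRing) (x : A) : Prop := exists y : A, x * y = 1.

Definition nilpotent (A : comRing) (x : A) : Prop :=
  exists m : nat, rexp x m = 0.

Definition rsum (A : comRing) (n : nat) (f : 'I_n -> A) : A :=
  \big[radd/0]_(i < n) f i.

Definition rdet (A : comRing) (n : nat) (M : 'I_n -> 'I_n -> A) : A :=
  \big[radd/0]_(s : 'S_n)
     ((if odd_perm s then - (1 : A) else 1) * \big[rmul/1]_(i < n) M i (s i)).

Definition in_ideal (A : comRing) (l : nat) (P : 'I_l -> A) (a : A) : Prop :=
  exists c : 'I_l -> A, a = rsum (fun i => c i * P i).

Definition is_ring_hom (A B : comRing) (f : A -> B) : Prop :=
  [/\ f 1 = 1,
      forall x y, f (x + y) = f x + f y
    & forall x y, f (x * y) = f x * f y].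

Record algebra (R : comRing) : Type := Algebra {
  alg_ring :> comRing;
  alg_in : R -> alg_ring;
  alg_inP : is_ring_hom alg_in
}.

Arguments alg_in {R a} _.

Record alg_hom (R : comRing) (A B : algebra R) : Type := AlgHom {
  hom_fun :> A -> B;
  hom_ringP : is_ring_hom hom_fun;
  hom_inP : forall r : R, hom_fun (alg_in r) = alg_in r
}.

Definition self_alg (R : comRing) : algebra R :=
  @Algebra R R id
    (And3 erefl (fun _ _ => erefl) (fun _ _ => erefl)).

Section FunctionAlgebra.
Variables (R : comRing) (T : Type).
Add Ring Rring : (rlaws R).

Lemma fun_laws :
  @ring_theory (T -> R) (fun _ => 0) (fun _ => 1)
    (fun f g t => f t + g t) (fun f g t => f t * g t)
    (fun f g t => f t - g t) (fun f t => - f t) eq.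
Proof.
by split=> *; apply: functional_extensionality => t; ring.
Qed.

Definition fun_ring : comRing := ComRing fun_laws.

Lemma fun_inP : @is_ring_hom R fun_ring (fun r _ => r).
Proof. by split. Qed.

Definition fun_alg : algebra R := Algebra fun_inP.
End FunctionAlgebra.

Section Polynomials.
Variables (R : comRing) (n : nat).

(** The polynomial ring is the free commutative [R]-algebra on [n] generators:
    terms modulo the congruence generated by the commutative ring laws and by
    the compatibility of constants with the operations of [R]. *)
Inductive pterm : Type :=
| PC of R
| PX of 'I_n
| PAdd of pterm & pterm
| PMul of pterm & pterm
| POpp of pterm.

Inductive peq : pterm -> pterm -> Prop :=
| peq_refl p : peq p p
| peq_sym p q : peq p q -> peq q p
| peq_trans p q s : peq p q -> peq q s -> peq p s
| peq_add p p' q q' : peq p p' -> peq q q' -> peq (PAdd p q) (PAdd p' q')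
| peq_mul p p' q q' : peq p p' -> peq q q' -> peq (PMul p q) (PMul p' q')
| peq_opp p p' : peq p p' -> peq (POpp p) (POpp p')
| peq_add0 p : peq (PAdd (PC 0) p) p
| peq_addC p q : peq (PAdd p q) (PAdd q p)
| peq_addA p q s : peq (PAdd p (PAdd q s)) (PAdd (PAdd p q) s)
| peq_mul1 p : peq (PMul (PC 1) p) p
| peq_mulC p q : peq (PMul p q) (PMul q p)
| peq_mulA p q s : peq (PMul p (PMul q s)) (PMul (PMul p q) s)
| peq_mulD p q s : peq (PMul (PAdd p q) s) (PAdd (PMul p s) (PMul q s))
| peq_oppr p : peq (PAdd p (POpp p)) (PC 0)
| peq_PCadd a b : peq (PC (a + b)) (PAdd (PC a) (PC b))
| peq_PCmul a b : peq (PC (a * b)) (PMul (PC a) (PC b)).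

Lemma peq_equiv : Equivalence peq.
Proof.
split; [exact: peq_refl | exact: peq_sym | exact: peq_trans].
Qed.

Definition poly_laws :
  @ring_theory (quot peq) (cls peq (PC 0)) (cls peq (PC 1))
    (quot_map2 peq_equiv peq_add) (quot_map2 peq_equiv peq_mul)
    (fun x y => quot_map2 peq_equiv peq_add x (quot_map1 peq_equiv peq_opp y))
    (quot_map1 peq_equiv peq_opp) eq.
Proof.
have E := cls_eq peq_equiv.
split.
- by move=> x; case: (clsP x) => p ->; rewrite quot_map2E; apply/E/peq_add0.
- move=> x y; case: (clsP x) => p ->; case: (clsP y) => q ->.
  by rewrite !quot_map2E; apply/E/peq_addC.
- move=> x y z; case: (clsP x) => p ->; case: (clsP y) => q ->.
  by case: (clsP z) => s ->; rewrite !quot_map2E; apply/E/peq_addA.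
- by move=> x; case: (clsP x) => p ->; rewrite quot_map2E; apply/E/peq_mul1.
- move=> x y; case: (clsP x) => p ->; case: (clsP y) => q ->.
  by rewrite !quot_map2E; apply/E/peq_mulC.
- move=> x y z; case: (clsP x) => p ->; case: (clsP y) => q ->.
  by case: (clsP z) => s ->; rewrite !quot_map2E; apply/E/peq_mulA.
- move=> x y z; case: (clsP x) => p ->; case: (clsP y) => q ->.
  by case: (clsP z) => s ->; rewrite !quot_map2E; apply/E/peq_mulD.
- by [].
- move=> x; case: (clsP x) => p ->.
  by rewrite quot_map1E quot_map2E; apply/E/peq_oppr.
Qed.

Definition poly_ring : comRing := ComRing poly_laws.

Lemma poly_inP : @is_ring_hom R poly_ring (fun r => cls peq (PC r)).
Proof.
have E := cls_eq peq_equiv.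
split=> //= x y; rewrite quot_map2E; apply/E.
  exact: peq_PCadd.
exact: peq_PCmul.
Qed.

Definition poly : algebra R := Algebra poly_inP.

Fixpoint pterm_deriv (j : 'I_n) (p : pterm) : pterm :=
  match p with
  | PC _ => PC 0
  | PX i => if i == j then PC 1 else PC 0
  | PAdd p q => PAdd (pterm_deriv j p) (pterm_deriv j q)
  | PMul p q => PAdd (PMul (pterm_deriv j p) q) (PMul p (pterm_deriv j q))
  | POpp p => POpp (pterm_deriv j p)
  end.

Add Ring polyring : (rlaws poly_ring).

Lemma pterm_derivP (j : 'I_n) (p q : pterm) :
  peq p q -> peq (pterm_deriv j p) (pterm_deriv j q).
Proof.
have E a b : peq a b <-> cls peq a = cls peq b :> poly_ring.
  by split=> /(cls_eq peq_equiv).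
have D a b : cls peq (PAdd a b) = (cls peq a : poly_ring) + cls peq b.
  by rewrite /= quot_map2E.
have M a b : cls peq (PMul a b) = (cls peq a : poly_ring) * cls peq b.
  by rewrite /= quot_map2E.
have O a : cls peq (POpp a) = - (cls peq a : poly_ring).
  by rewrite /= quot_map1E.
have Z : cls peq (PC 0) = 0 :> poly_ring by [].
have I : cls peq (PC 1) = 1 :> poly_ring by [].
elim=> {p q} [p|p q _|p q s _ IH1 _ IH2|p p' q q' _ IH1 _ IH2
  |p p' q q' H1 IH1 H2 IH2|p p' _ IH|p|p q|p q s|p|p q|p q s|p q s|p|a b|a b] /=.
- exact: peq_refl.
- exact: peq_sym.
- exact: peq_trans IH2.
- exact: peq_add.
- by apply: peq_add; apply: peq_mul.
- exact: peq_opp.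
- exact: peq_add0.
- exact: peq_addC.
- exact: peq_addA.
- apply/E; rewrite !(D, M, Z, I); ring.
- apply/E; rewrite !(D, M); ring.
- apply/E; rewrite !(D, M); ring.
- apply/E; rewrite !(D, M); ring.
- exact: peq_oppr.
- apply/E; rewrite !(D, Z); ring.
- apply/E; rewrite !(D, M, Z); ring.
Qed.

Definition pderiv (j : 'I_n) : poly -> poly :=
  quot_map1 peq_equiv (@pterm_derivP j).

End Polynomials.

Section QuotientAlgebra.
Variables (R : comRing) (A : algebra R) (l : nat) (P : 'I_l -> A).
Add Ring Aring : (rlaws A).

Definition ieq (a b : A) : Prop := in_ideal P (b - a).

Lemma in_ideal0 : in_ideal P 0.
Proof.
exists (fun _ => 0); rewrite /rsum big1 // => i _; ring.
Qed.

Lemma in_idealD a b : in_ideal P a -> in_ideal P b -> in_ideal P (a + b).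
Proof.
case=> c -> [d ->]; exists (fun i => c i + d i); rewrite /rsum -big_split /=.
apply: eq_bigr => i _; ring.
Qed.

Lemma in_idealM a b : in_ideal P b -> in_ideal P (a * b).
Proof.
case=> c ->; exists (fun i => a * c i); rewrite /rsum.
apply: (big_ind2 (fun x y => a * x = y)) => [|x1 x2 y1 y2 <- <-|i _]; ring.
Qed.

Lemma ieq_equiv : Equivalence ieq.
Proof.
split.
- move=> a; rewrite /ieq; have -> : a - a = 0 by ring.
  exact: in_ideal0.
- move=> a b /(in_idealM (- (1 : A))).
  rewrite /ieq; suff -> : - (1 : A) * (b - a) = a - b by [].
  ring.
- move=> a b c Hab Hbc; rewrite /ieq.
  have -> : c - a = (b - a) + (c - b) by ring.
  exact: in_idealD.
Qed.

Lemma ieq_add a b c d : ieq a b -> ieq c d -> ieq (a + c) (b + d).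
Proof.
move=> H1 H2; rewrite /ieq.
have -> : b + d - (a + c) = (b - a) + (d - c) by ring.
exact: in_idealD.
Qed.

Lemma ieq_mul a b c d : ieq a b -> ieq c d -> ieq (a * c) (b * d).
Proof.
move=> H1 H2; rewrite /ieq.
have -> : b * d - a * c = d * (b - a) + a * (d - c) by ring.
by apply: in_idealD; apply: in_idealM.
Qed.

Lemma ieq_opp a b : ieq a b -> ieq (- a) (- b).
Proof.
move=> /(in_idealM (- (1 : A))); rewrite /ieq.
by have -> : - (1 : A) * (b - a) = - b - - a by ring.
Qed.

Lemma quo_laws :
  @ring_theory (quot ieq) (cls ieq 0) (cls ieq 1)
    (quot_map2 ieq_equiv ieq_add) (quot_map2 ieq_equiv ieq_mul)
    (fun x y => quot_map2 ieq_equiv ieq_add x (quot_map1 ieq_equiv ieq_opp y))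
    (quot_map1 ieq_equiv ieq_opp) eq.
Proof.
split=> //.
- move=> x; case: (clsP x) => p ->; rewrite quot_map2E; congr (cls _ _); ring.
- move=> x y; case: (clsP x) => p ->; case: (clsP y) => q ->.
  rewrite !quot_map2E; congr (cls _ _); ring.
- move=> x y z; case: (clsP x) => p ->; case: (clsP y) => q ->.
  case: (clsP z) => s ->; rewrite !quot_map2E; congr (cls _ _); ring.
- move=> x; case: (clsP x) => p ->; rewrite quot_map2E; congr (cls _ _); ring.
- move=> x y; case: (clsP x) => p ->; case: (clsP y) => q ->.
  rewrite !quot_map2E; congr (cls _ _); ring.
- move=> x y z; case: (clsP x) => p ->; case: (clsP y) => q ->.
  case: (clsP z) => s ->; rewrite !quot_map2E; congr (cls _ _); ring.
- move=> x y z; case: (clsP x) => p ->; case: (clsP y) => q ->.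
  case: (clsP z) => s ->; rewrite !quot_map2E; congr (cls _ _); ring.
- move=> x; case: (clsP x) => p ->; rewrite quot_map1E quot_map2E.
  congr (cls _ _); ring.
Qed.

Definition quo_ring : comRing := ComRing quo_laws.

Definition quo_proj : A -> quo_ring := cls ieq.

Lemma quo_inP : is_ring_hom (fun r : R => quo_proj (alg_in r)).
Proof.
case: (alg_inP A) => H1 HD HM; rewrite /quo_proj.
by split=> [|x y|x y] /=; rewrite ?quot_map2E ?H1 ?HD ?HM.
Qed.

Definition quo_alg : algebra R := Algebra quo_inP.

End QuotientAlgebra.

Definition fin_pres (R : comRing) (A : algebra R) : Prop :=
  exists (n l : nat) (P : 'I_l -> poly R n) (f : alg_hom A (quo_alg P)),
    bijective f.

Definition Spec (R : comRing) (A : algebra R) : Type :=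
  alg_hom A (self_alg R).

Definition is_local (R : comRing) : Prop :=
  (1 : R) <> 0 /\
  forall x y : R, is_unit (x + y) -> is_unit x \/ is_unit y.

Section Duality.
Variables (R : comRing) (A : algebra R).

Definition ev (a : A) : fun_alg R (Spec A) := fun x => x a.

Lemma ev_ringP : is_ring_hom ev.
Proof.
by split=> [|a b|a b]; apply: functional_extensionality => x;
  case: (hom_ringP x) => H1 HD HM /=; rewrite /ev ?H1 ?HD ?HM.
Qed.

Lemma ev_inP (r : R) : ev (alg_in r) = alg_in r.
Proof. by apply: functional_extensionality => x; exact: (hom_inP x). Qed.

Definition ev_hom : alg_hom A (fun_alg R (Spec A)) := AlgHom ev_ringP ev_inP.
End Duality.

Definition duality (R : comRing) : Prop :=
  forall A : algebra R, fin_pres A -> bijective (ev_hom A).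

Definition zariski_local_choice (R : comRing) : Prop :=
  forall A : algebra R, fin_pres A ->
  forall B : Spec A -> Type, (forall x, inhabited (B x)) ->
  exists (n : nat) (f : 'I_n -> A),
    in_ideal f 1 /\
    inhabited (forall (i : 'I_n) (x : {x : Spec A | is_unit (x (f i))}),
                 B (sval x)).

Section Schemes.
Variable R : comRing.

Definition open_prop (P : Prop) : Prop :=
  exists (n : nat) (r : 'I_n -> R), P <-> exists i, r i <> 0.

Definition open_subtype (X : Type) (U : X -> Prop) : Prop :=
  forall x, open_prop (U x).

Definition affine_scheme (X : Type) : Prop :=
  exists (A : algebra R) (f : X -> Spec A), fin_pres A /\ bijective f.

Definition scheme (X : Type) : Prop :=
  exists (n : nat) (U : 'I_n -> X -> Prop),
    [/\ forall i, open_subtype (U i),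
        forall x, exists i, U i x
      & forall i, affine_scheme {x : X | U i x}].

Definition closed_dense (P : Prop) : Prop :=
  exists (n : nat) (r : 'I_n -> R),
    (forall i, nilpotent (r i)) /\ (P <-> forall i, r i = 0).

Definition formally_smooth (X : Type) : Prop :=
  forall P : Prop, closed_dense P ->
  surjective (fun (x : X) (_ : P) => x).

Definition smooth_scheme (X : Type) : Prop := scheme X /\ formally_smooth X.

Definition D1 : Type := {e : R | e * e = 0}.

Definition D2 : Type :=
  {p : R * R | [/\ p.1 * p.1 = 0, p.1 * p.2 = 0 & p.2 * p.2 = 0]}.

Add Ring RringD : (rlaws R).

Lemma mul00 : (0 : R) * 0 = 0. Proof. ring. Qed.
Lemma mulx0 (x : R) : x * 0 = 0. Proof. ring. Qed.
Lemma mul0x (x : R) : 0 * x = 0. Proof. ring. Qed.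

Lemma D1_scaleP (r : R) (e : D1) : (r * sval e) * (r * sval e) = 0.
Proof.
have -> : (r * sval e) * (r * sval e) = (r * r) * (sval e * sval e) by ring.
by rewrite (svalP e) mulx0.
Qed.

Definition D1_0 : D1 := exist _ 0 mul00.

Definition D1_scale (r : R) (e : D1) : D1 := exist _ _ (D1_scaleP r e).

Definition D2_0 : D2 := exist _ (0, 0) (And3 mul00 mul00 mul00).

Definition D2_axis1 (e : D1) : D2 :=
  exist _ (sval e, 0) (And3 (svalP e) (mulx0 (sval e)) mul00).

Definition D2_axis2 (e : D1) : D2 :=
  exist _ (0, sval e) (And3 mul00 (mul0x (sval e)) (svalP e)).

Definition D2_diag (e : D1) : D2 :=
  exist _ (sval e, sval e) (And3 (svalP e) (svalP e) (svalP e)).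

Definition tangent (X : Type) (x : X) : Type := {t : D1 -> X | t D1_0 = x}.

Section Tangent.
Variables (X : Type) (x : X).

Lemma tscaleP (r : R) (v : tangent x) :
  sval v (D1_scale r D1_0) = x.
Proof.
rewrite -[RHS](svalP v); congr (sval v _).
rewrite /D1_scale; move: (D1_scaleP r D1_0) => /=; rewrite mulx0 => H.
by rewrite /D1_0 (proof_irrelevance _ H mul00).
Qed.

Definition tscale (r : R) (v : tangent x) : tangent x :=
  exist _ (fun e => sval v (D1_scale r e)) (tscaleP r v).

(** [psi] is a pointed map on [D2] restricting to [v] and [w] on the axes. *)
Definition glues (v w : tangent x) (psi : D2 -> X) : Prop :=
  [/\ psi D2_0 = x,
      forall e, psi (D2_axis1 e) = sval v e
    & forall e, psi (D2_axis2 e) = sval w e].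

(** The graph of addition of tangent vectors; it is the graph of an operation
    as soon as each pair of tangent vectors is glued by a unique [psi]. *)
Definition is_tsum (v w s : tangent x) : Prop :=
  exists psi : D2 -> X, glues v w psi /\ forall e, sval s e = psi (D2_diag e).

(** The tangent space at [x] is isomorphic to [R ^ k] as an [R]-module; the
    first clause says that its addition is well defined. *)
Definition tangent_free (k : nat) : Prop :=
  (forall v w : tangent x, exists! psi : D2 -> X, glues v w psi) /\
  exists f : tangent x -> ('I_k -> R),
    [/\ bijective f,
        forall r v i, f (tscale r v) i = r * f v i
      & forall v w s, is_tsum v w s -> forall i, f s i = f v i + f w i].

End Tangent.

Definition smooth_of_dim (k : nat) (X : Type) : Prop :=
  smooth_scheme X /\ forall x : X, tangent_free x k.

(** The variables of [poly R (n + k)] are [X_j = lshift k j] for [j < n] and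
    [Y_j = rshift n j] for [j < k]. *)
Definition standard_smooth (k : nat) (X : Type) : Prop :=
  exists (n : nat) (P : 'I_n -> poly R (n + k)) (f : X -> Spec (quo_alg P)),
    bijective f /\
    is_unit (quo_proj P (rdet (fun i j => pderiv (lshift k j) (P i)))).

End Schemes.

(* Main.v *)
From Stdlib Require Import FunctionalExtensionality ProofIrrelevance Ring.
From Stdlib Require Import RelationClasses.
From HB Require Import structures.
From mathcomp Require Import all_boot.
From mathcomp Require Import fingroup perm.
Require Import Defs.

Set Implicit Arguments.
Unset Strict Implicit.
Unset Printing Implicit Defensive.

Local Open Scope cring_scope.

(** A standard smooth scheme is the set of zeros in affine space of [n]
    polynomials in [n + k] variables whose Jacobian matrix in the first [n]
    variables, the [X], is invertible at each zero. Everything follows from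
    this invertibility, and duality serves to replace functions by polynomials.

    Formal smoothness.  A point given under the hypothesis that finitely many
    nilpotents [r] vanish has coordinates defined under that hypothesis only;
    by duality they extend to elements of [R], which solve the equations modulo
    the ideal of [r] ([function_on_closed], [vanishing_on_closed]).  A Newton
    step turns a solution modulo an ideal [I] into a solution modulo any ideal
    that contains the products of two elements of [I] ([newton_step]), because
    the remainder in the Taylor expansion is made of such products ([taylor]).
    An ideal generated by finitely many nilpotents is exhausted in finitely
    many steps, treating one generator after another ([lifts_nilpotents]).  The
    solution so obtained is congruent to the first one modulo [r], hence equal
    to it wherever [r] vanishes.

    Tangent spaces.  By duality, maps from [D1] and [D2] to [R] are affine with
    unique coefficients ([D1_affine], [D2_affine], [D1_cancel]).  A tangent
    vector is thus a velocity vector in affine space, and by the Taylor formula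
    the velocities that occur are the vectors annihilated by the differentials
    of the equations ([slope_kernel], [tangent_of_kernel]).  Two velocities
    [a] and [b] are glued by the plane [x + a e1 + b e2], so that addition
    of tangent vectors is the addition of velocities.  Since the Jacobian
    matrix in the [X] is invertible, its kernel is the graph of a linear map
    from the [k] coordinates [Y] to the [n] coordinates [X] ([kernel_graph]),
    and the [Y]-coordinates of the velocity identify the tangent space with
    [R ^ k]. *)

(** * Finite sums and Cramer's rule *)

Lemma rmul0x (R : comRing) : left_zero (0 : R) rmul.
Proof. exact: mul0x. Qed.

Lemma rmulx0 (R : comRing) : right_zero (0 : R) rmul.
Proof. exact: mulx0. Qed.

Lemma rmulDl (R : comRing) : left_distributive (@rmul R) radd.
Proof. exact: (Rdistr_l (rlaws R)). Qed.

Lemma rmulDr (R : comRing) : right_distributive (@rmul R) radd.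
Proof.
by move=> x y z; rewrite !(Rmul_comm (rlaws R) x) rmulDl.
Qed.

HB.instance Definition _ (R : comRing) :=
  Monoid.isMulLaw.Build R r0 rmul (@rmul0x R) (@rmulx0 R).

HB.instance Definition _ (R : comRing) :=
  Monoid.isAddLaw.Build R rmul radd (@rmulDl R) (@rmulDr R).

Section Cramer.
Variable R : comRing.
Add Ring Rring : (rlaws R).

Lemma rsum_delta n (a : 'I_n -> R) (k : 'I_n) (d : R) :
  rsum (fun j => a j * (if j == k then d else 0)) = a k * d.
Proof.
rewrite /rsum (bigD1 k) //= eqxx big1 => [|j /negPf ->]; ring.
Qed.

Lemma eq_rsum n (a b : 'I_n -> R) : (forall i, a i = b i) -> rsum a = rsum b.
Proof. by move=> ab; apply: eq_bigr => i _. Qed.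

Lemma rsum_assoc m n (a : 'I_m -> R) (B : 'I_m -> 'I_n -> R) (c : 'I_n -> R) :
  rsum (fun j => rsum (fun l => a l * B l j) * c j)
  = rsum (fun l => a l * rsum (fun j => B l j * c j)).
Proof.
rewrite /rsum; under eq_bigr do rewrite big_distrl /=.
rewrite exchange_big /=; apply: eq_bigr => l _.
by rewrite big_distrr /=; apply: eq_bigr => j _; ring.
Qed.

Lemma rsumD n (a b : 'I_n -> R) :
  rsum (fun i => a i + b i) = rsum a + rsum b.
Proof. exact: big_split. Qed.

Lemma rsumZ n (r : R) (a : 'I_n -> R) :
  rsum (fun i => r * a i) = r * rsum a.
Proof. by rewrite /rsum big_distrr. Qed.

Lemma rsum0 n (a : 'I_n -> R) : (forall i, a i = 0) -> rsum a = 0.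
Proof. by move=> a0; apply: big1 => i _. Qed.

Variable n : nat.
Implicit Types (M : 'I_n -> 'I_n -> R) (i j k : 'I_n).

Definition rsign (s : 'S_n) : R := if odd_perm s then - (1 : R) else 1.

Lemma rdet_tr M : rdet (fun i j => M j i) = rdet M.
Proof.
rewrite /rdet (reindex_inj (@invg_inj _)) /=; apply: eq_bigr => s _.
rewrite odd_permV (reindex_perm s) /=; congr (_ * _).
by apply: eq_bigr => i _; rewrite permK.
Qed.

Lemma rdet_alternate M i1 i2 :
  i1 != i2 -> (forall j, M i1 j = M i2 j) -> rdet M = 0.
Proof.
move=> ne12 eq12; pose t := tperm i1 i2.
have oddMt s : odd_perm (t * s)%g = ~~ odd_perm s.
  by rewrite odd_permM odd_tperm ne12.
rewrite /rdet (bigID (@odd_perm _)) /= (reindex_inj (mulgI t)) /=.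
under eq_bigl do rewrite oddMt.
rewrite -big_split /= big1 // => s /negPf es.
rewrite oddMt es /= (reindex_perm t) /=.
have -> : \big[rmul/1]_(i < n) M (t i) ((t * s)%g (t i))
        = \big[rmul/1]_(i < n) M i (s i).
  apply: eq_bigr => i _; rewrite permM tpermK /t.
  by case: tpermP => // ->; rewrite eq12.
set X := \big[_/_]_(_ < _) _; move: X => X. ring.
Qed.

(** Signed minors, written as the part of the Leibniz expansion of the
    determinant in which the row [i] meets the column [j]: removing a row and
    a column would require renumbering the others. *)
Definition cofactor M i j : R :=
  \big[radd/0]_(s : 'S_n | s i == j)
     (rsign s * \big[rmul/1]_(k | k != i) M k (s k)).

(** Expanding along row [i] with the entries of row [k] gives the determinant
    of the matrix whose row [i] has been overwritten by row [k], which has a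
    repeated row as soon as [k] differs from [i]. *)
Lemma cramer_row M k i :
  rsum (fun j => M k j * cofactor M i j) = if k == i then rdet M else 0.
Proof.
pose M' a j := if a == i then M k j else M a j.
have -> : rsum (fun j => M k j * cofactor M i j) = rdet M'.
  rewrite /rdet (partition_big (fun s : 'S_n => s i) predT) //=.
  apply: eq_bigr => j _; rewrite big_distrr; apply: eq_bigr => s /eqP sij.
  rewrite [in RHS](bigD1 i) //= /M' eqxx sij.
  under [in RHS]eq_bigr => a /negPf ne do rewrite ne.
  rewrite /rsign; ring.
case: eqVneq => [ki|ne].
  by apply: eq_bigr => s _; congr (_ * _); apply: eq_bigr => a _;
     rewrite /M'; case: eqP => // ->; rewrite ki.
apply: (rdet_alternate ne) => j; rewrite /M' eqxx.
by rewrite (negPf ne).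
Qed.

Definition is_inverse M (N : 'I_n -> 'I_n -> R) :=
  (forall i k, rsum (fun j => M i j * N j k) = if i == k then 1 else 0) /\
  (forall i k, rsum (fun j => N i j * M j k) = if i == k then 1 else 0).

Lemma right_inverse_of_unit M u : rdet M * u = 1 ->
  forall i k, rsum (fun j => M i j * (cofactor M k j * u))
              = if i == k then 1 else 0.
Proof.
move=> Mu i k.
have -> : rsum (fun j => M i j * (cofactor M k j * u))
        = rsum (fun j => M i j * cofactor M k j) * u.
  by rewrite /rsum big_distrl /=; apply: eq_bigr => j _; ring.
by rewrite cramer_row; case: eqP => _ //; ring.
Qed.

(** The transposed matrix has the same determinant, so that [M] has a right
    inverse and a left inverse; these coincide. *)
Lemma inverse_of_unit_det M : is_unit (rdet M) -> exists N, is_inverse M N.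
Proof.
case=> u Mu; pose N j k := cofactor M k j * u.
have MN := right_inverse_of_unit Mu.
have MtN : rdet (fun i j => M j i) * u = 1 by rewrite rdet_tr.
have {MtN} NM := right_inverse_of_unit MtN.
pose L i j := cofactor (fun i j => M j i) i j * u.
have LM i k : rsum (fun j => L i j * M j k) = if i == k then 1 else 0.
  rewrite eq_sym -NM; apply: eq_bigr => j _; rewrite /L; ring.
exists N; split=> // i k; rewrite -LM; apply: eq_bigr => j _.
congr (_ * _); transitivity (rsum (fun l => L i l * (if l == j then 1 else 0))).
  under eq_rsum do rewrite -MN.
  rewrite -(rsum_assoc (L i) M (N^~ j)).
  under eq_rsum do rewrite LM (Rmul_comm (rlaws R)) eq_sym.
  by rewrite rsum_delta; ring.
by rewrite rsum_delta; ring.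
Qed.
End Cramer.

(** * Evaluation of polynomials *)

Section QuotientRecursion.
Variable uc : unique_choice.
Variables (T U : Type) (E : T -> T -> Prop) (equivE : Equivalence E).
Variables (f : T -> U) (fE : forall a b, E a b -> f a = f b).

Lemma quot_rec_subproof (s : quot E) :
  exists! u, forall a, sval s a -> f a = u.
Proof.
case: (clsP s) => a ->; exists (f a); split=> [b /fE //|u]; apply.
by rewrite /=; reflexivity.
Qed.

(** A class is a predicate, from which a representative cannot be extracted;
    the common value of [f] on it can, being unique. *)
Definition quot_rec (s : quot E) : U := sval (uc (quot_rec_subproof s)).

Lemma quot_recE a : quot_rec (cls E a) = f a.
Proof.
rewrite /quot_rec; case: (uc _) => u /= Hu.
by rewrite (Hu a) //; reflexivity.
Qed.
End QuotientRecursion.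

Section Evaluation.
Variables (R : comRing) (n : nat) (z : 'I_n -> R).
Add Ring Rring : (rlaws R).

Fixpoint pterm_eval (t : pterm R n) : R :=
  match t with
  | PC a => a
  | PX i => z i
  | PAdd p q => pterm_eval p + pterm_eval q
  | PMul p q => pterm_eval p * pterm_eval q
  | POpp p => - pterm_eval p
  end.

Lemma pterm_eval_peq p q : peq p q -> pterm_eval p = pterm_eval q.
Proof.
by elim=> {p q} /=; intros; first [congruence | ring].
Qed.

Variable uc : unique_choice.

Definition peval : poly R n -> R :=
  quot_rec uc (peq_equiv R n) pterm_eval_peq.

Lemma peval_cls t : peval (cls _ t) = pterm_eval t.
Proof. exact: quot_recE. Qed.

Lemma peval_hom : is_ring_hom peval.
Proof.
split=> [|x y|x y]; first exact: peval_cls.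
  by case: (clsP x) => p ->; case: (clsP y) => q ->;
    rewrite /= quot_map2E !peval_cls.
by case: (clsP x) => p ->; case: (clsP y) => q ->;
  rewrite /= quot_map2E !peval_cls.
Qed.

Lemma peval_in r : peval (alg_in r) = r.
Proof. exact: peval_cls. Qed.
End Evaluation.

(** * Ring homomorphisms and ideals *)

Section RingHom.
Variables (A B : comRing) (f : A -> B) (fP : is_ring_hom f).
Add Ring Aring : (rlaws A).
Add Ring Bring : (rlaws B).

Lemma hom1 : f 1 = 1. Proof. by case: fP. Qed.
Lemma homD x y : f (x + y) = f x + f y. Proof. by case: fP. Qed.
Lemma homM x y : f (x * y) = f x * f y. Proof. by case: fP. Qed.

Lemma hom0 : f 0 = 0.
Proof.
have -> : f 0 = f 0 + f 0 - f 0 by ring.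
rewrite -homD (Radd_0_l (rlaws A)); ring.
Qed.

Lemma homN x : f (- x) = - f x.
Proof.
have -> : f (- x) = f (- x) + f x - f x by ring.
rewrite -homD; have -> : - x + x = 0 by ring.
rewrite hom0; ring.
Qed.

Lemma hom_sum n (a : 'I_n -> A) : f (rsum a) = rsum (fun i => f (a i)).
Proof. exact: (big_morph f homD hom0). Qed.

Lemma hom_det n (M : 'I_n -> 'I_n -> A) :
  f (rdet M) = rdet (fun i j => f (M i j)).
Proof.
rewrite /rdet (big_morph f homD hom0); apply: eq_bigr => s _.
rewrite homM (big_morph f homM hom1); congr (_ * _).
by case: ifP; rewrite ?homN hom1.
Qed.
End RingHom.

Definition is_ideal (R : comRing) (I : R -> Prop) :=
  [/\ I 0, forall a b, I a -> I b -> I (a + b) & forall a b, I b -> I (a * b)].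

Lemma zero_ideal (R : comRing) : is_ideal (fun r : R => r = 0).
Proof.
by split=> // [a b -> ->|a b ->]; rewrite ?rmulx0 ?(Radd_0_l (rlaws R)).
Qed.

Lemma in_ideal_ideal (R : comRing) l (r : 'I_l -> R) : is_ideal (in_ideal r).
Proof.
split; first exact: (@in_ideal0 R (self_alg R)).
  exact: (@in_idealD R (self_alg R)).
exact: (@in_idealM R (self_alg R)).
Qed.

Lemma in_ideal_gen (R : comRing) (A : algebra R) l (P : 'I_l -> A) i :
  in_ideal P (P i).
Proof.
exists (fun j => if j == i then 1 else 0); rewrite -[LHS](Rmul_1_l (rlaws A)).
rewrite (Rmul_comm (rlaws A)) -rsum_delta; apply: eq_rsum => j.
by rewrite (Rmul_comm (rlaws A)).
Qed.

Lemma quo_proj_hom (R : comRing) (A : algebra R) l (P : 'I_l -> A) :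
  is_ring_hom (quo_proj P).
Proof. by split=> // x y; rewrite /quo_proj /= quot_map2E. Qed.

Section QuoProj.
Variables (R : comRing) (A : algebra R) (l : nat) (P : 'I_l -> A).
Add Ring Aring : (rlaws A).

Lemma quo_proj_eq a b : quo_proj P a = quo_proj P b <-> in_ideal P (b - a).
Proof. exact: cls_eq (ieq_equiv P) a b. Qed.

Lemma quo_proj_eq0 a : quo_proj P a = 0 <-> in_ideal P a.
Proof.
have -> : (0 : quo_ring P) = quo_proj P 0 by [].
split=> [e|Pa].
  by have /quo_proj_eq := esym e; rewrite (_ : a - 0 = a) //; ring.
by apply/esym/quo_proj_eq; rewrite (_ : a - 0 = a) //; ring.
Qed.

Lemma quo_projP (x : quo_ring P) : exists a, x = quo_proj P a.
Proof. exact: clsP. Qed.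
End QuoProj.

Lemma alg_hom_ext (R : comRing) (A B : algebra R) (f g : alg_hom A B) :
  (forall a, f a = g a) -> f = g.
Proof.
case: f g => [f f1 f2] [g g1 g2] /= fg.
have e : f = g by apply: functional_extensionality.
by subst g; rewrite (proof_irrelevance _ f1 g1) (proof_irrelevance _ f2 g2).
Qed.

(** * Points of the spectrum of a finitely presented algebra *)

Section Points.
Variable uc : unique_choice.
Variables (R : comRing) (n l : nat) (P : 'I_l -> poly R n).
Add Ring Rring : (rlaws R).
Add Ring Pring : (rlaws (poly R n)).
Implicit Types (z : 'I_n -> R) (x : Spec (quo_alg P)).

Definition is_zero z := forall i, peval z uc (P i) = 0.

Definition coords x : 'I_n -> R := fun i => x (quo_proj P (cls _ (PX R i))).

(** Polynomials are generated by constants and variables, so a point of the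
    spectrum is determined by its coordinates. *)
Lemma point_eval x p : x (quo_proj P p) = peval (coords x) uc p.
Proof.
case: (clsP p) => t ->; rewrite peval_cls.
have xP := hom_ringP x; have pP := quo_proj_hom P.
elim: t => [r|i|p1 IH1 p2 IH2|p1 IH1 p2 IH2|p1 IH1] //=.
- exact: (hom_inP x r).
- by rewrite -IH1 -IH2 -(homD xP) -(homD pP) /= quot_map2E.
- by rewrite -IH1 -IH2 -(homM xP) -(homM pP) /= quot_map2E.
- by rewrite -IH1 -(homN xP) -(homN pP) /= quot_map1E.
Qed.

Lemma coords_zero x : is_zero (coords x).
Proof.
move=> i; rewrite -point_eval.
have -> : quo_proj P (P i) = 0 by apply/quo_proj_eq0/in_ideal_gen.
exact: hom0 (hom_ringP x).
Qed.

Lemma peval_ideal z p (I : R -> Prop) :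
  is_ideal I ->
  (forall i, I (peval z uc (P i))) -> in_ideal P p -> I (peval z uc p).
Proof.
case=> I0 ID IM Iz [c ->]; rewrite (hom_sum (peval_hom z uc)).
by apply: big_ind => // i _; rewrite (homM (peval_hom z uc)); apply: IM.
Qed.

Lemma peval_ieq z : is_zero z ->
  forall a b, ieq P a b -> peval z uc a = peval z uc b.
Proof.
move=> zP a b Pab.
have : peval z uc (b - a) = 0.
  exact: peval_ideal (@zero_ideal R) zP Pab.
rewrite (homD (peval_hom z uc)) (homN (peval_hom z uc)) => e.
have -> : peval z uc b = peval z uc b - peval z uc a + peval z uc a by ring.
by rewrite e; ring.
Qed.

Section Point.
Variables (z : 'I_n -> R) (zP : is_zero z).

Definition point_fun : quo_alg P -> self_alg R :=
  quot_rec uc (ieq_equiv P) (peval_ieq zP).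

Lemma point_funE p : point_fun (quo_proj P p) = peval z uc p.
Proof. exact: quot_recE. Qed.

Lemma point_fun_hom : is_ring_hom point_fun.
Proof.
have [e1 eD eM] := peval_hom z uc; have pP := quo_proj_hom P.
split=> [|x y|x y]; first by rewrite -(hom1 pP) point_funE e1.
  case: (quo_projP x) => a ->; case: (quo_projP y) => b ->.
  by rewrite -(homD pP) !point_funE eD.
case: (quo_projP x) => a ->; case: (quo_projP y) => b ->.
by rewrite -(homM pP) !point_funE eM.
Qed.

Lemma point_fun_in r : point_fun (alg_in r) = alg_in r.
Proof. by rewrite -[LHS]/(point_fun (quo_proj P (alg_in r))) point_funE peval_in. Qed.

Definition point : Spec (quo_alg P) := AlgHom point_fun_hom point_fun_in.

Lemma coords_point : coords point = z.
Proof.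
by apply: functional_extensionality => i; rewrite /coords /= point_funE peval_cls.
Qed.
End Point.

Lemma coords_inj x y : coords x = coords y -> x = y.
Proof.
move=> xy; apply: alg_hom_ext => a; case: (quo_projP a) => p ->.
by rewrite !point_eval xy.
Qed.

Lemma fin_pres_quo : fin_pres (quo_alg P).
Proof.
have idP : @is_ring_hom (quo_alg P) (quo_alg P) id by split.
by exists n, l, P, (AlgHom idP (fun _ => erefl)); exists id.
Qed.

Hypothesis dual : duality R.

(** Surjectivity of the duality map, read on the zero locus of [P]. *)
Lemma function_is_poly (phi : forall z, is_zero z -> R) :
  exists p, forall z (zP : is_zero z), phi z zP = peval z uc p.
Proof.
have [g _ evK] := dual fin_pres_quo.
have [p gp] := quo_projP (g (fun x => phi (coords x) (coords_zero x))).
exists p => z zP.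
have := f_equal (fun F => F (point zP)) (evK (fun x => phi (coords x) (coords_zero x))).
rewrite gp /= /ev /= point_funE => ->.
move: (coords_zero (point zP)); rewrite coords_point => zP'.
by rewrite (proof_irrelevance _ zP' zP).
Qed.

(** Injectivity of the duality map: a Nullstellensatz without radicals. *)
Lemma vanishing_in_ideal p :
  (forall z, is_zero z -> peval z uc p = 0) -> in_ideal P p.
Proof.
have [g gK _] := dual fin_pres_quo => p0; apply/quo_proj_eq0.
rewrite -[LHS]gK -[RHS]gK; congr g; apply: functional_extensionality => x.
rewrite /= /ev point_eval p0; last exact: coords_zero.
by rewrite (hom0 (hom_ringP x)).
Qed.
End Points.

(** * Taylor expansion *)

Section Taylor.
Variables (R : comRing) (n : nat).
Add Ring Rring : (rlaws R).
Implicit Types (z h : 'I_n -> R).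

Definition vadd n (z h : 'I_n -> R) : 'I_n -> R := fun j => z j + h j.

Lemma ideal_rsum m (I : R -> Prop) (a : 'I_m -> R) :
  is_ideal I -> (forall i, I (a i)) -> I (rsum a).
Proof. by case=> I0 ID _ Ia; apply: big_ind. Qed.

Variables (I J : R -> Prop).
Hypotheses (idealI : is_ideal I) (idealJ : is_ideal J).
Hypothesis IIJ : forall a b, I a -> I b -> J (a * b).

(** By induction on terms. In a product of two expansions, the only term that
    is not a multiple of one of the remainders is the product of the two linear
    parts, and these lie in [I]. *)
Lemma pterm_taylor z h (t : pterm R n) : (forall j, I (h j)) ->
  J (pterm_eval (vadd z h) t
     - (pterm_eval z t
        + rsum (fun j => pterm_eval z (pterm_deriv j t) * h j))).
Proof.
move=> Ih; set D := fun t => rsum (fun j => pterm_eval z (pterm_deriv j t) * h j).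
rewrite -/(D t).
have [J0 JD JM] := idealJ; have [_ _ IM] := idealI.
have ID s : I (D s) by apply: ideal_rsum => // j; apply: IM.
elim: t => [r|i|p IHp q IHq|p IHp q IHq|p IHp] /=.
- rewrite /D rsum0 => [|j]; last by rewrite /= rmul0x.
  by rewrite (_ : r - (r + 0) = 0) //; ring.
- rewrite /D (@eq_rsum _ _ _ (fun j => h j * (if j == i then 1 else 0))).
    by rewrite rsum_delta /vadd (_ : z i + h i - _ = 0) //; ring.
  by move=> j; rewrite /= eq_sym; case: eqP => _ /=; ring.
- have -> : D (PAdd p q) = D p + D q.
    by rewrite /D -rsumD; apply: eq_rsum => j /=; ring.
  move: (JD _ _ IHp IHq); congr J; ring.
- have -> : D (PMul p q) = pterm_eval z q * D p + pterm_eval z p * D q.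
    by rewrite /D -!rsumZ -rsumD; apply: eq_rsum => j /=; ring.
  have := JD _ _ (JM (pterm_eval (vadd z h) q) _ IHp)
            (JD _ _ (JM (pterm_eval z p + D p) _ IHq) (IIJ (ID p) (ID q))).
  congr J; ring.
- have -> : D (POpp p) = - (1) * D p.
    by rewrite /D -rsumZ; apply: eq_rsum => j /=; ring.
  move: (JM (- (1)) _ IHp); congr J; ring.
Qed.

Variable uc : unique_choice.

Definition differential z (p : poly R n) h : R :=
  rsum (fun j => peval z uc (pderiv j p) * h j).

(** The remainder of the first order expansion is a combination of products of
    two increments. *)
Lemma taylor z h (p : poly R n) : (forall j, I (h j)) ->
  J (peval (vadd z h) uc p - (peval z uc p + differential z p h)).
Proof.
case: (clsP p) => t -> Ih; rewrite !peval_cls /differential.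
rewrite (@eq_rsum _ _ _ (fun j => pterm_eval z (pterm_deriv j t) * h j)).
  exact: pterm_taylor.
by move=> j; rewrite /pderiv quot_map1E peval_cls.
Qed.
End Taylor.

Section FirstOrder.
Variables (R : comRing) (uc : unique_choice) (n : nat).
Add Ring Rring : (rlaws R).
Implicit Types (z h : 'I_n -> R) (p : poly R n).

Lemma taylor_exact z h p : (forall i j, h i * h j = 0) ->
  peval (vadd z h) uc p = peval z uc p + differential uc z p h.
Proof.
move=> h0; set a := peval _ _ _; set b := _ + _.
suff e : a - b = 0 by have -> : a = a - b + b by [ring]; rewrite e; ring.
apply: (taylor (in_ideal_ideal h) (@zero_ideal R)) => [r s [c ->] [d ->]|j].
  rewrite -rsumZ rsum0 // => i.
  rewrite (Rmul_comm (rlaws R)) -rsumZ rsum0 // => j.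
  have -> : d i * h i * (c j * h j) = d i * c j * (h i * h j) by ring.
  by rewrite h0 rmulx0.
exact: (@in_ideal_gen R (self_alg R)).
Qed.

Lemma differentialD z p h1 h2 :
  differential uc z p (vadd h1 h2)
  = differential uc z p h1 + differential uc z p h2.
Proof. by rewrite /differential -rsumD; apply: eq_rsum => j; rewrite rmulDr. Qed.

Lemma differentialZ z p r h :
  differential uc z p (fun j => r * h j) = r * differential uc z p h.
Proof. by rewrite /differential -rsumZ; apply: eq_rsum => j; ring. Qed.
End FirstOrder.

(** * Newton iteration *)

Section Newton.
Variables (R : comRing) (uc : unique_choice) (n k : nat).
Variable P : 'I_n -> poly R (n + k).
Add Ring Rring : (rlaws R).
Implicit Types (z : 'I_(n + k) -> R) (I J K : R -> Prop).

Definition join (a : 'I_n -> R) (b : 'I_k -> R) : 'I_(n + k) -> R :=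
  fun m => match split m with inl j => a j | inr j => b j end.

Lemma join_lshift a b j : join a b (lshift k j) = a j.
Proof. by rewrite /join -[lshift k j]/(unsplit (inl _)) unsplitK. Qed.

Lemma join_rshift a b j : join a b (rshift n j) = b j.
Proof. by rewrite /join -[rshift n j]/(unsplit (inr _)) unsplitK. Qed.

Definition jacX z i j := peval z uc (pderiv (lshift k j) (P i)).
Definition jacY z i j := peval z uc (pderiv (rshift n j) (P i)).

Lemma differential_split z i h :
  differential uc z (P i) h
  = rsum (fun j => jacX z i j * h (lshift k j))
    + rsum (fun j => jacY z i j * h (rshift n j)).
Proof. exact: big_split_ord. Qed.

Hypothesis unit_jac :
  is_unit (quo_proj P (rdet (fun i j => pderiv (lshift k j) (P i)))).

(** The determinant is invertible in the algebra presented by [P], that is,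
    up to a combination of the equations, whose values at [z] lie in [I]. *)
Lemma jac_unit_mod I z : is_ideal I -> (forall i, I (peval z uc (P i))) ->
  exists u, I (rdet (jacX z) * u - 1).
Proof.
move=> idealI Iz; have [y] := unit_jac; have [q ->] := quo_projP y.
have pP := quo_proj_hom P; have eP := peval_hom z uc.
rewrite -(homM pP) -(hom1 pP) => /esym/quo_proj_eq Pdq.
exists (peval z uc q); move: (peval_ideal idealI Iz Pdq).
by rewrite (homD eP) (homN eP) (homM eP) (hom1 eP) (hom_det eP).
Qed.

Definition lifts I J := forall z, (forall i, I (peval z uc (P i))) ->
  exists z', (forall j, I (z' j - z j)) /\ forall i, J (peval z' uc (P i)).

(** The Newton step moves the [X]-coordinates by minus an approximate inverse
    of the Jacobian matrix applied to the values of [P], all of which lie in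
    [I]: the inverse is needed modulo [I] only, as its error is multiplied by
    these values. *)
Lemma newton_step I J : is_ideal I -> is_ideal J ->
  (forall a b, I a -> I b -> J (a * b)) -> lifts I J.
Proof.
move=> idealI idealJ IIJ z Iz; have [u Iu] := jac_unit_mod idealI Iz.
have [I0 _ IM] := idealI; have [_ JD JM] := idealJ.
pose g i := peval z uc (P i).
pose a j := - u * rsum (fun l => g l * cofactor (jacX z) l j).
pose h := join a (fun _ => 0).
have Ih j : I (h j).
  rewrite /h /join; case: split => // i; apply/IM.
  by apply: ideal_rsum => // l; rewrite (Rmul_comm (rlaws R)); apply/IM/Iz.
exists (vadd z h); split=> [j|i].
  by rewrite /vadd (_ : z j + h j - z j = h j) //; ring.
have eq_diff : differential uc z (P i) h = - u * (g i * rdet (jacX z)).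
  rewrite differential_split [X in _ + X]rsum0; last first.
    by move=> j; rewrite /h join_rshift rmulx0.
  transitivity (- u * rsum (fun j => rsum (fun l => g l * cofactor (jacX z) l j)
                                       * jacX z i j)).
    rewrite -rsumZ (@eq_rsum _ _ _ (fun j => jacX z i j * a j)).
      rewrite (Radd_comm (rlaws R)) (Radd_0_l (rlaws R)).
      by apply: eq_rsum => j; rewrite /a; ring.
    by move=> j; rewrite /h join_lshift.
  rewrite rsum_assoc -rsum_delta; congr (_ * _); apply: eq_rsum => l.
  congr (_ * _); rewrite eq_sym -cramer_row.
  by apply: eq_rsum => j; ring.
have JT := taylor idealI idealJ IIJ uc z (P i) Ih.
have := JD _ _ JT (JM (- (1)) _ (IIJ _ _ Iu (Iz i))).
congr J; rewrite eq_diff -/(g i); ring.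
Qed.

Lemma lifts_trans I J K : is_ideal I -> (forall a, J a -> I a) ->
  lifts I J -> lifts J K -> lifts I K.
Proof.
move=> [_ ID _] JI LIJ LJK z /LIJ [z1 [Iz1 /LJK [z2 [Jz2 Kz2]]]].
exists z2; split=> // j.
have -> : z2 j - z j = (z2 j - z1 j) + (z1 j - z j) by ring.
by apply: ID; [exact: JI | exact: Iz1].
Qed.

Lemma lifts_refl I J : is_ideal I -> (forall a, I a -> J a) -> lifts I J.
Proof.
move=> [I0 _ _] IJ z Iz; exists z; split=> [j|i]; last exact: IJ.
by rewrite (_ : z j - z j = 0) //; ring.
Qed.

Definition adjoin J (s : R) : R -> Prop :=
  fun x => exists a b, J b /\ x = a * s + b.

Lemma adjoin_ideal J s : is_ideal J -> is_ideal (adjoin J s).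
Proof.
move=> [J0 JD JM]; split.
- by exists 0, 0; split=> //; ring.
- move=> _ _ [a [b [Jb ->]]] [a' [b' [Jb' ->]]].
  by exists (a + a'), (b + b'); split; [exact: JD | ring].
- move=> c _ [a [b [Jb ->]]].
  by exists (c * a), (c * b); split; [exact: JM | ring].
Qed.

(** For positive [e], the square of the ideal [J + (s ^ e)] is contained in
    [J + (s ^ (e + 1))], so that each Newton step gains one power of [s]. *)
Lemma lifts_power J s m : is_ideal J ->
  lifts (adjoin J s) (adjoin J (rexp s m.+1)).
Proof.
move=> idealJ; have [J0 JD JM] := idealJ.
have sub e a : adjoin J (rexp s e.+1) a -> adjoin J s a.
  move=> [c [b [Jb ->]]]; exists (c * rexp s e), b; split=> //=; ring.
elim: m => [|m IHm].
  apply: lifts_refl => [|_ [a [b [Jb ->]]]]; first exact: adjoin_ideal.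
  by exists a, b; split=> //=; ring.
refine (lifts_trans (adjoin_ideal s idealJ) (sub m) IHm _).
apply: newton_step; [exact: adjoin_ideal | exact: adjoin_ideal |].
move=> _ _ [a [b [Jb ->]]] [a' [b' [Jb' ->]]].
exists (a * a' * rexp s m), (a * rexp s m.+1 * b' + (a' * rexp s m.+1 + b') * b).
split; last by rewrite /=; ring.
by apply: JD; apply: JM.
Qed.

Lemma lifts_nilpotent J s : is_ideal J -> nilpotent s -> lifts (adjoin J s) J.
Proof.
move=> idealJ [m sm0].
refine (lifts_trans (adjoin_ideal s idealJ) _ (lifts_power m idealJ) _).
  move=> _ [a [b [Jb ->]]]; exists (a * rexp s m), b; split=> //=; ring.
apply: lifts_refl => [|_ [a [b [Jb ->]]]]; first exact: adjoin_ideal.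
by rewrite /= sm0 (_ : a * (s * 0) + b = b) //; ring.
Qed.

Lemma lifts_nilpotents m (r : 'I_m -> R) :
  (forall i, nilpotent (r i)) -> lifts (in_ideal r) (fun a => a = 0).
Proof.
elim: m r => [|m IHm] r nil_r.
  apply: lifts_refl => [|_ [c ->]]; first exact: in_ideal_ideal.
  by rewrite /rsum big_ord0.
pose r' i := r (lift ord0 i).
have eq_ideal a : in_ideal r a <-> adjoin (in_ideal r') (r ord0) a.
  split=> [[c ->]|[b [_ [[c ->] ->]]]].
    exists (c ord0), (rsum (fun i => c (lift ord0 i) * r' i)).
    by split; [eexists | rewrite /rsum big_ord_recl].
  exists (fun i => oapp c b (unlift ord0 i)); rewrite /rsum big_ord_recl.
  rewrite unlift_none; congr (_ + _).
  by apply: eq_bigr => i _; rewrite liftK.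
have idealr' := in_ideal_ideal r'.
apply: (@lifts_trans _ (adjoin (in_ideal r') (r ord0)) _).
- exact: in_ideal_ideal.
- by move=> a /eq_ideal.
- by apply: lifts_refl => [|a /eq_ideal //]; exact: in_ideal_ideal.
refine (lifts_trans _ _ (lifts_nilpotent idealr' (nil_r ord0)) _).
- exact: adjoin_ideal.
- by move=> a r'a; exists 0, a; split=> //; ring.
- by apply: IHm => i; apply: nil_r.
Qed.
End Newton.

(** * Functions on infinitesimals *)

Section ClosedPropositions.
Variables (R : comRing) (uc : unique_choice) (dual : duality R).
Variables (m : nat) (r : 'I_m -> R).

(** The proposition that all [r i] vanish is the spectrum of [R] modulo these
    constants, seen as polynomials in no variables. *)
Let Q (i : 'I_m) : poly R 0 := alg_in (r i).
(* The only point of the affine space of dimension zero. *)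
Let pt : 'I_0 -> R := fun _ => 0.

Let is_zeroQ z : is_zero uc Q z <-> forall i, r i = 0.
Proof. by split=> H i; move: (H i); rewrite peval_in. Qed.

Lemma function_on_closed (phi : (forall i, r i = 0) -> R) :
  exists w, forall r0, phi r0 = w.
Proof.
have [p Hp] := function_is_poly dual (fun z zP => phi (proj1 (is_zeroQ z) zP)).
exists (peval pt uc p) => r0; rewrite -(Hp pt (proj2 (is_zeroQ pt) r0)).
by congr phi; apply: proof_irrelevance.
Qed.

Lemma vanishing_on_closed w :
  ((forall i, r i = 0) -> w = 0) -> in_ideal r w.
Proof.
move=> w0; have : in_ideal Q (alg_in w).
  by apply: (vanishing_in_ideal (uc := uc) dual) => z /is_zeroQ; rewrite peval_in.
move/(peval_ideal (uc := uc) (in_ideal_ideal r)) => /(_ pt); rewrite peval_in.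
by apply=> i; rewrite peval_in; apply: (@in_ideal_gen R (self_alg R)).
Qed.
End ClosedPropositions.

Section PolyDerivative.
Variables (R : comRing) (uc : unique_choice) (n : nat) (z : 'I_n -> R).
Implicit Types p q : poly R n.

Lemma peval_pderivD j p q :
  peval z uc (pderiv j (p + q))
  = peval z uc (pderiv j p) + peval z uc (pderiv j q).
Proof.
case: (clsP p) => s ->; case: (clsP q) => t ->.
by rewrite /= quot_map2E /pderiv !quot_map1E !peval_cls.
Qed.

Lemma peval_pderivM j p q :
  peval z uc (pderiv j (p * q))
  = peval z uc (pderiv j p) * peval z uc q
    + peval z uc p * peval z uc (pderiv j q).
Proof.
case: (clsP p) => s ->; case: (clsP q) => t ->.
by rewrite /= quot_map2E /pderiv !quot_map1E !peval_cls.
Qed.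

Lemma peval_pderiv_sum j l (p : 'I_l -> poly R n) :
  peval z uc (pderiv j (rsum p)) = rsum (fun i => peval z uc (pderiv j (p i))).
Proof.
apply: (big_morph (fun p => peval z uc (pderiv j p)) (peval_pderivD j)).
by rewrite /= /pderiv quot_map1E peval_cls.
Qed.
End PolyDerivative.

Section Infinitesimals.
Variables (R : comRing) (uc : unique_choice) (dual : duality R) (m : nat).
Add Ring Rring : (rlaws R).

Definition infinitesimal m (h : 'I_m -> R) := forall i j, h i * h j = 0.

Let Q (i : 'I_#|{: 'I_m * 'I_m}|) : poly R m :=
  cls _ (PMul (PX R (enum_val i).1) (PX R (enum_val i).2)).

Let is_zeroQ h : is_zero uc Q h <-> infinitesimal h.
Proof.
split=> H i => [j|]; last by rewrite peval_cls; apply: H.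
by have := H (enum_rank (i, j)); rewrite peval_cls /= enum_rankK.
Qed.

Let o : 'I_m -> R := fun _ => 0.

Lemma infinitesimal0 : infinitesimal o.
Proof. by move=> i j; apply: rmul0x. Qed.

(** By duality a function is a polynomial, and on infinitesimals a polynomial
    equals its first order expansion at the origin. *)
Lemma function_on_infinitesimals (phi : forall h, infinitesimal h -> R) :
  exists b : 'I_m -> R, forall h hP,
    phi h hP = phi o infinitesimal0 + rsum (fun i => b i * h i).
Proof.
have [p Hp] := function_is_poly dual (fun h hP => phi h (proj1 (is_zeroQ h) hP)).
have {}Hp h hP : phi h hP = peval h uc p.
  rewrite -(Hp h (proj2 (is_zeroQ h) hP)).
  by congr phi; apply: proof_irrelevance.
exists (fun i => peval o uc (pderiv i p)) => h hP; rewrite !Hp.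
rewrite -/(differential uc o p h) -taylor_exact //; congr (peval _ _ _).
by apply: functional_extensionality => i; rewrite /vadd /o; ring.
Qed.

(** A linear form that vanishes on infinitesimals lies in the ideal generated
    by the products of two variables, whose elements have no linear part. *)
Lemma linear_form_eq0 (b : 'I_m -> R) :
  (forall h, infinitesimal h -> rsum (fun i => b i * h i) = 0) ->
  forall i, b i = 0.
Proof.
move=> b0 j.
pose L : poly R m := rsum (fun i => cls _ (PMul (PC m (b i)) (PX R i)) : poly R m).
have : in_ideal Q L.
  apply: (vanishing_in_ideal (uc := uc) dual) => h /is_zeroQ /b0 <-.
  rewrite /L (hom_sum (peval_hom h uc)).
  by apply: eq_rsum => i; rewrite peval_cls.
case=> c /(f_equal (fun p => peval o uc (pderiv j p))).
rewrite !peval_pderiv_sum [RHS]rsum0 => [<-|i]; last first.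
  rewrite peval_pderivM /Q /pderiv quot_map1E !peval_cls /= /o; ring.
rewrite (@eq_rsum _ _ _ (fun i => b i * (if i == j then 1 else 0))).
  by rewrite rsum_delta; ring.
by move=> i; rewrite /pderiv quot_map1E peval_cls /= /o; case: eqP => _ /=; ring.
Qed.
End Infinitesimals.

Section D1D2.
Variables (R : comRing) (uc : unique_choice) (dual : duality R).
Add Ring Rring : (rlaws R).

Lemma D1_ext (e e' : D1 R) : sval e = sval e' -> e = e'.
Proof.
case: e e' => [e eP] [e' e'P] /= ee; subst e'.
by rewrite (proof_irrelevance _ eP e'P).
Qed.

Lemma D2_ext (e e' : D2 R) : sval e = sval e' -> e = e'.
Proof.
case: e e' => [e eP] [e' e'P] /= ee; subst e'.
by rewrite (proof_irrelevance _ eP e'P).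
Qed.

Lemma D1_cancel (a b : R) : (forall e : D1 R, a * sval e = b * sval e) -> a = b.
Proof.
move=> ab; suff e0 : a - b = 0 by have -> : a = a - b + b by [ring]; rewrite e0; ring.
apply: (linear_form_eq0 uc dual (b := fun _ : 'I_1 => a - b) _ ord0) => h hP.
rewrite /rsum big_ord_recl big_ord0.
have := ab (exist _ (h ord0) (hP ord0 ord0)); rewrite /= => abh.
have -> : (a - b) * h ord0 = a * h ord0 - b * h ord0 by ring.
rewrite abh; ring.
Qed.

Lemma D1_affine (phi : D1 R -> R) :
  exists b, forall e, phi e = phi (D1_0 R) + b * sval e.
Proof.
have [b Hb] := function_on_infinitesimals uc dual
  (fun (h : 'I_1 -> R) hP => phi (exist _ (h ord0) (hP ord0 ord0))).
exists (b ord0) => e.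
have := Hb (fun _ => sval e) (fun _ _ => svalP e).
rewrite /rsum big_ord_recl big_ord0.
rewrite (_ : exist _ _ _ = e); last exact: D1_ext.
rewrite (_ : exist _ _ _ = D1_0 R); last exact: D1_ext.
by move=> ->; ring.
Qed.

Lemma D2_affine (phi : D2 R -> R) : exists b1 b2, forall e,
  phi e = phi (D2_0 R) + b1 * (sval e).1 + b2 * (sval e).2.
Proof.
pose i0 : 'I_2 := ord0; pose i1 : 'I_2 := lift ord0 ord0.
have [b Hb] := function_on_infinitesimals uc dual
  (fun (h : 'I_2 -> R) hP =>
     phi (exist _ (h i0, h i1) (And3 (hP i0 i0) (hP i0 i1) (hP i1 i1)))).
exists (b i0), (b i1) => e.
pose h (i : 'I_2) := if i == i0 then (sval e).1 else (sval e).2.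
have hP : infinitesimal h.
  have [e1 e2 e3] := svalP e.
  move=> i j; rewrite /h; do 2!case: ifP => _ //.
  by rewrite (Rmul_comm (rlaws R)).
have := Hb h hP; rewrite /rsum !big_ord_recl big_ord0.
rewrite (_ : exist _ _ _ = e); last by apply: D2_ext; rewrite /h /=; case: (sval e).
rewrite (_ : exist _ _ _ = D2_0 R); last exact: D2_ext.
by move=> ->; rewrite /h /= /i0 /i1; ring.
Qed.
End D1D2.

(** * Smoothness *)

(** [X] is presented as the zero locus of [P]: [c] gives the coordinates and
    [mk] the point with given coordinates. *)
Section Smooth.
Variables (R : comRing) (uc : unique_choice) (dual : duality R) (n k : nat).
Variable P : 'I_n -> poly R (n + k).
Hypothesis unit_jac :
  is_unit (quo_proj P (rdet (fun i j => pderiv (lshift k j) (P i)))).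
Variables (X : Type) (c : X -> 'I_(n + k) -> R).
Variable mk : forall z, is_zero uc P z -> X.
Hypotheses (c_zero : forall x, is_zero uc P (c x))
  (c_mk : forall z zP, c (@mk z zP) = z)
  (c_inj : forall x y, c x = c y -> x = y).
Add Ring Rring : (rlaws R).

(** Over the proposition that the nilpotents [r] vanish, a point has
    coordinates which are the restriction of elements of [R]; these solve the
    equations modulo the ideal of [r], and Newton iteration corrects them
    without changing their classes modulo that ideal. *)
Lemma formally_smooth_zeros : formally_smooth R X.
Proof.
move=> T [m [r [nil_r TP]]] y.
have [z Hz] : exists z : 'I_(n + k) -> R, forall j r0, c (y (proj2 TP r0)) j = z j.
  apply: (fin_all_exists (P := fun j zj => forall r0, c (y (proj2 TP r0)) j = zj)) => j.
  exact: (function_on_closed uc dual (fun r0 => c (y (proj2 TP r0)) j)).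
have Iz i : in_ideal r (peval z uc (P i)).
  apply: (vanishing_on_closed uc dual) => r0.
  have <- : c (y (proj2 TP r0)) = z by apply: functional_extensionality => j.
  exact: c_zero.
have [z' [Iz' z'P]] := lifts_nilpotents unit_jac nil_r Iz.
exists (mk z'P); apply: functional_extensionality => t; apply: c_inj.
have r0 := proj1 TP t; rewrite c_mk (proof_irrelevance _ t (proj2 TP r0)).
apply: functional_extensionality => j; rewrite Hz.
have z'z : z' j - z j = 0.
  have [d ->] := Iz' j; apply: rsum0 => i; rewrite r0; exact: rmulx0.
have -> : z' j = z' j - z j + z j by ring.
rewrite z'z; ring.
Qed.

Section TangentSpace.
Variable x : X.
Implicit Types (v w : tangent R x) (a h : 'I_(n + k) -> R).

Definition line a (e : R) : 'I_(n + k) -> R := vadd (c x) (fun j => a j * e).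

Lemma slope_ex v : exists! a, forall e, c (sval v e) = line a (sval e).
Proof.
have [a Ha] : exists a, forall j (e : D1 R), c (sval v e) j = c x j + a j * sval e.
  apply: (fin_all_exists (P := fun j d =>
    forall e : D1 R, c (sval v e) j = c x j + d * sval e)) => j.
  have [b Hb] := D1_affine uc dual (fun e => c (sval v e) j).
  by exists b => e; rewrite Hb (svalP v).
exists a; split=> [e|b Hb]; apply: functional_extensionality => j //.
apply: (D1_cancel uc dual) => e.
have := Ha j e; rewrite Hb /line /vadd => E.
have -> : a j * sval e = c x j + a j * sval e - c x j by ring.
by rewrite -E; ring.
Qed.

(** The velocity of a tangent vector in the ambient affine space. *)
Definition slope v := sval (uc (slope_ex v)).

Lemma slopeP v e : c (sval v e) = line (slope v) (sval e).
Proof. exact: svalP (uc (slope_ex v)) e. Qed.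

Lemma slope_unique v a :
  (forall e, c (sval v e) = line a (sval e)) -> slope v = a.
Proof.
have [b [_ Ub]] := slope_ex v.
by move=> /Ub <-; rewrite -(Ub _ (slopeP v)).
Qed.

Definition in_kernel a := forall i, differential uc (c x) (P i) a = 0.

Lemma zero_vadd h : infinitesimal h -> in_kernel h -> is_zero uc P (vadd (c x) h).
Proof.
by move=> hh hK i; rewrite taylor_exact // hK c_zero (Radd_0_l (rlaws R)).
Qed.

Lemma infinitesimal_line a (e : D1 R) : infinitesimal (fun j => a j * sval e).
Proof.
move=> i j; have -> : a i * sval e * (a j * sval e) = a i * a j * (sval e * sval e).
  by ring.
by rewrite (svalP e) rmulx0.
Qed.

Lemma in_kernelZ r a : in_kernel a -> in_kernel (fun j => a j * r).
Proof.
move=> aK i; rewrite -[RHS](rmulx0 r) -(aK i) -differentialZ.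
by apply: eq_rsum => j; rewrite (Rmul_comm (rlaws R) r).
Qed.

Lemma in_kernelD a b : in_kernel a -> in_kernel b -> in_kernel (vadd a b).
Proof. by move=> aK bK i; rewrite differentialD aK bK (Radd_0_l (rlaws R)). Qed.

Lemma slope_kernel v : in_kernel (slope v).
Proof.
move=> i; apply: (D1_cancel uc dual) => e; rewrite rmul0x.
have := c_zero (sval v e) i; rewrite slopeP taylor_exact; last first.
  exact: infinitesimal_line.
rewrite c_zero (Radd_0_l (rlaws R)) => E; rewrite -[RHS]E.
rewrite (Rmul_comm (rlaws R)) -differentialZ.
by apply: eq_rsum => j; rewrite (Rmul_comm (rlaws R) (sval e)).
Qed.

Section TangentOfKernel.
Variables (a : 'I_(n + k) -> R) (aK : in_kernel a).

Lemma line_zero (e : D1 R) : is_zero uc P (line a (sval e)).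
Proof. by apply: zero_vadd; [exact: infinitesimal_line | exact: in_kernelZ]. Qed.

Lemma line_origin : mk (line_zero (D1_0 R)) = x.
Proof.
apply: c_inj; rewrite c_mk; apply: functional_extensionality => j.
by rewrite /line /vadd /=; ring.
Qed.

Definition tangent_of_kernel : tangent R x :=
  exist _ (fun e => mk (line_zero e)) line_origin.

Lemma slope_tangent_of_kernel : slope tangent_of_kernel = a.
Proof. by apply: slope_unique => e; rewrite /= c_mk. Qed.
End TangentOfKernel.

Lemma slope_inj v w : slope v = slope w -> v = w.
Proof.
move=> vw; have e : sval v = sval w.
  by apply: functional_extensionality => e; apply: c_inj; rewrite !slopeP vw.
case: v w e {vw} => [f fx] [g gx] /= e; subst g.
by rewrite (proof_irrelevance _ fx gx).
Qed.

Definition plane v w (e : R * R) : 'I_(n + k) -> R :=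
  vadd (c x) (vadd (fun j => slope v j * e.1) (fun j => slope w j * e.2)).

(** Both coefficients of a map on [D2] are determined by its values on the
    axes. *)
Lemma glues_plane v w psi : glues v w psi ->
  forall e, c (psi e) = plane v w (sval e).
Proof.
move=> [psi0 psi1 psi2] e; apply: functional_extensionality => j.
have [b1 [b2 Hb]] := D2_affine uc dual (fun e => c (psi e) j).
rewrite Hb psi0 /plane /vadd.
have -> : b1 = slope v j.
  apply: (D1_cancel uc dual) => d; have := Hb (D2_axis1 d).
  rewrite psi1 slopeP psi0 /line /vadd /= => E.
  have -> : b1 * sval d = c x j + b1 * sval d + b2 * 0 - c x j by ring.
  by rewrite -E; ring.
have -> : b2 = slope w j.
  apply: (D1_cancel uc dual) => d; have := Hb (D2_axis2 d).
  rewrite psi2 slopeP psi0 /line /vadd /= => E.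
  have -> : b2 * sval d = c x j + b1 * 0 + b2 * sval d - c x j by ring.
  by rewrite -E; ring.
ring.
Qed.

Lemma plane_zero v w (e : D2 R) : is_zero uc P (plane v w (sval e)).
Proof.
have [e11 e12 e22] := svalP e; apply: zero_vadd.
  move=> i j; rewrite /vadd; move: e11 e12 e22; case: (sval e) => d1 d2 /= H1 H2 H3.
  transitivity (slope v i * slope v j * (d1 * d1)
    + (slope v i * slope w j + slope w i * slope v j) * (d1 * d2)
    + slope w i * slope w j * (d2 * d2)); first by ring.
  by rewrite H1 H2 H3; ring.
by apply: in_kernelD; apply: in_kernelZ; apply: slope_kernel.
Qed.

(** The plane spanned by two tangent vectors consists of zeros because the
    kernel is stable under addition. *)
Lemma glues_exists_unique v w : exists! psi, glues v w psi.
Proof.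
exists (fun e => mk (plane_zero v w e)); split=> [|psi Hpsi]; last first.
  apply: functional_extensionality => e; apply: c_inj.
  by rewrite c_mk (glues_plane Hpsi).
split=> [|e|e]; apply: c_inj; rewrite c_mk ?slopeP;
  apply: functional_extensionality => j; rewrite /plane /line /vadd /=; ring.
Qed.

Lemma slope_scale r v j : slope (tscale r v) j = r * slope v j.
Proof.
rewrite (@slope_unique _ (fun j => r * slope v j)) // => e.
rewrite /= slopeP /=; apply: functional_extensionality => i.
by rewrite /line /vadd; ring.
Qed.

Lemma slope_sum v w s j : is_tsum v w s -> slope s j = slope v j + slope w j.
Proof.
case=> psi [Hpsi Hs]; rewrite (@slope_unique _ (vadd (slope v) (slope w))) // => e.
rewrite Hs (glues_plane Hpsi); apply: functional_extensionality => i.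
by rewrite /plane /line /vadd /=; ring.
Qed.

Lemma jac_unit : is_unit (rdet (jacX uc P (c x))).
Proof.
have [u Hu] := jac_unit_mod unit_jac (@zero_ideal R) (c_zero x).
exists u; set d := _ * _ in Hu *.
have -> : d = d - 1 + 1 by ring.
by rewrite Hu; ring.
Qed.

(** As the Jacobian matrix in the variables [X] is invertible, the vectors of
    the kernel are the graph of a linear function of their [Y]-coordinates. *)
Lemma kernel_graph : exists F : ('I_k -> R) -> ('I_n -> R),
  (forall b, in_kernel (join (F b) b)) /\
  (forall a, in_kernel a ->
     a = join (F (fun j => a (rshift n j))) (fun j => a (rshift n j))).
Proof.
have [N [MN NM]] := inverse_of_unit_det jac_unit.
(* The equations of the kernel are M a + w b = 0, with solution a = - N (w b). *)
pose w (b : 'I_k -> R) i := rsum (fun j => jacY uc P (c x) i j * b j).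
pose F b i := - (1) * rsum (fun l => N i l * w b l).
exists F; split=> [b i|a aK].
  rewrite differential_split.
  have -> : rsum (fun j => jacY uc P (c x) i j * join (F b) b (rshift n j)) = w b i.
    by apply: eq_rsum => j; rewrite join_rshift.
  rewrite (@eq_rsum _ _ _
    (fun j => - (1) * (jacX uc P (c x) i j * rsum (fun l => N j l * w b l)))).
    rewrite rsumZ -rsum_assoc.
    rewrite (@eq_rsum _ _ _ (fun l => w b l * (if l == i then 1 else 0))).
      by rewrite rsum_delta; ring.
    by move=> l; rewrite MN eq_sym (Rmul_comm (rlaws R)).
  by move=> j; rewrite join_lshift /F; ring.
apply: functional_extensionality => m; rewrite -[m](splitK m).
case: (split m) => j /=; rewrite ?join_lshift ?join_rshift //.
pose a' l := a (lshift k l).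
have aw l : w (fun j => a (rshift n j)) l
          = - (1) * rsum (fun i => jacX uc P (c x) l i * a' i).
  have := aK l; rewrite differential_split -/(w _ l) => E.
  set s := rsum _ in E *; set t := w _ _ in E *.
  have -> : t = s + t - s by ring.
  by rewrite E; ring.
rewrite /F (@eq_rsum _ _ _
  (fun l => - (1) * (N j l * rsum (fun i => jacX uc P (c x) l i * a' i)))).
  rewrite rsumZ -rsum_assoc.
  rewrite (@eq_rsum _ _ _ (fun l => a' l * (if l == j then 1 else 0))).
    by rewrite rsum_delta /a'; ring.
  by move=> l; rewrite NM eq_sym (Rmul_comm (rlaws R)).
by move=> l; rewrite aw; ring.
Qed.

Lemma tangent_free_zeros : tangent_free R x k.
Proof.
split; first exact: glues_exists_unique.
have [F [FK KF]] := kernel_graph.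
exists (fun v j => slope v (rshift n j)); split.
- exists (fun b => tangent_of_kernel (FK b)) => [v|b].
    by apply: slope_inj; rewrite slope_tangent_of_kernel -KF //; apply: slope_kernel.
  apply: functional_extensionality => j.
  by rewrite slope_tangent_of_kernel join_rshift.
- by move=> r v j; apply: slope_scale.
- by move=> v w s vws j; apply: slope_sum.
Qed.
End TangentSpace.
End Smooth.

Lemma scheme_affine (R : comRing) (X : Type) :
  (1 : R) <> 0 -> affine_scheme R X -> scheme R X.
Proof.
move=> R1 [A [f [Afp [g fK gK]]]].
exists 1%N, (fun _ _ => True); split=> [_ x|x|_]; last 1 first.
- exists A, (fun x => f (sval x)); split=> //.
  by exists (fun y => exist _ (g y) I) => [[x []]|y] /=; rewrite ?fK ?gK.
- by exists 1%N, (fun _ => 1); split=> // _; exists ord0.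
- by exists ord0.
Qed.

Theorem lemma4p3p4 (R : comRing) (uniqueChoice : unique_choice)
    (locality : is_local R) (R_duality : duality R)
    (localChoice : zariski_local_choice R) (k : nat) (X : Type) :
  standard_smooth R k X -> smooth_of_dim R k X.
Proof.
move=> [n [P [f [[g fK gK] unit_jac]]]].
pose c x := coords (f x).
pose mk z (zP : is_zero uniqueChoice P z) := g (point zP).
have c_zero x : is_zero uniqueChoice P (c x) by apply: coords_zero.
have c_mk z zP : c (@mk z zP) = z by rewrite /c /mk gK coords_point.
have c_inj x y : c x = c y -> x = y.
  by move=> /(coords_inj uniqueChoice) /(can_inj fK).
split; last exact: tangent_free_zeros c_zero c_mk c_inj.
split; last exact: formally_smooth_zeros c_zero c_mk c_inj.
apply: scheme_affine; first by case: locality.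
by exists (quo_alg P), f; split; [exact: fin_pres_quo | exists g].
Qed.
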